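(* Let $V$ be a finite set with $n=|V|$ and let $\mathcal{P}=(P_t)_{t\ge1}$ be a sequence of irreducible, lazy, and reversible transition matrices on $V$. Suppose that all $P_t$ have the same stationary distribution $\pi$. Consider the pull voting over opinion set $\Sigma$ according to $\mathcal{P}$. Then, the process finally agrees with $\sigma\in\Sigma$ with probability $$\sum_{v\in V_\sigma}\pi(v),$$ where $V_\sigma\subseteq V$ is the set of vertices initially holding opinion $\sigma$.
   Context: A transition matrix $P\in[0,1]^{V\times V}$ is a row-stochastic matrix. It is irreducible if for all $u,v\in V$ there is $t>0$ with $P^t(u,v)>0$; lazy if $P(v,v)\ge 1/2$ for all $v\in V$; a probability distribution $\pi$ is a stationary distribution of $P$ if $\pi P=\pi$; $P$ is reversible (with respect to its stationary distribution $\pi$) if $\pi(u)P(u,v)=\pi(v)P(v,u)$ for all $u,v\in V$. Pull voting according to $\mathcal{P}$: each vertex of $V$ holds an opinion from a finite set $\Sigma\subseteq\{0,\dots,n-1\}$, starting from a given initial opinion configuration. At round $t\ge1$, simultaneously and independently, each vertex $u$ picks a vertex $v$ according to the distribution $P_t(u,\cdot)$ and replaces its opinion by the opinion that $v$ held at the beginning of the round. The process finally agrees with $\sigma$ if it reaches the consensus configuration in which every vertex holds opinion $\sigma$.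
   Formalization: Added: either the irreducibility of the P_t is uniform in t (step count bounded above, probability bounded below), or consensus is reached almost surely; otherwise false, e.g. two vertices with P_t(0,1)=P_t(1,0)=4^{-t} may never agree. *)

(* Defs.v *)
From HB Require Import structures.
From mathcomp Require Import all_boot all_order all_algebra.
From mathcomp Require Import all_classical all_reals all_analysis.

Set Implicit Arguments.
Unset Strict Implicit.
Unset Printing Implicit Defensive.

Import Order.TTheory GRing.Theory Num.Theory.

Local Open Scope classical_set_scope.
Local Open Scope ring_scope.

Section TransitionMatrices.
Context {R : realType} {V : finType}.
Implicit Types (P : V -> V -> R) (pi : V -> R).

Definition transition_matrix P : Prop :=
  (forall u v, 0 <= P u v <= 1) /\ (forall u, \sum_v P u v = 1).

Fixpoint mpow P (t : nat) : V -> V -> R :=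
  if t is t'.+1 then fun u v => \sum_w P u w * mpow P t' w v
  else fun u v => (u == v)%:R.

Definition irreducible P : Prop :=
  forall u v, exists2 t, (0 < t)%N & 0 < mpow P t u v.

Definition lazy P : Prop := forall v, 2^-1 <= P v v.

Definition prob_distribution pi : Prop :=
  (forall v, 0 <= pi v) /\ \sum_v pi v = 1.

Definition stationary P pi : Prop :=
  prob_distribution pi /\ forall v, \sum_u pi u * P u v = pi v.

Definition reversible P pi : Prop :=
  forall u v, pi u * P u v = pi v * P v u.

(* A sequence (P_t)_{t >= 1} is indexed by nat; its term of index 0 is unused.

   Irreducibility with a number of steps and a lower bound on the probability
   that are uniform in t.  It follows from the irreducibility of each P_t as
   soon as the positive entries of all the P_t are bounded away from 0, in
   particular when only finitely many different matrices occur.  Pull voting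
   with irreducible P_t that converge fast to the identity, on the other hand,
   has a positive probability never to reach a consensus.                     *)
Definition uniformly_irreducible (P : nat -> V -> V -> R) : Prop :=
  exists (K : nat) (eps : R), 0 < eps /\
    forall t u v, (0 < t)%N ->
      exists2 k, (0 < k <= K)%N & eps <= mpow (P t) k u v.

End TransitionMatrices.

Section PullVoting.
Context {R : realType} {V : finType}.

(* [N t u w] is the vertex picked by [u] at round [t >= 1] in the outcome [w]. *)
Record pull_choices d (Omega : measurableType d) (Pr : probability Omega R)
    (P : nat -> V -> V -> R) (N : nat -> V -> Omega -> V) : Prop := {
  choice_measurable : forall t u (B : set V), (0 < t)%N ->
    measurable (N t u @^-1` B);
  choice_law : forall t u v, (0 < t)%N ->
    Pr (N t u @^-1` [set v]) = (P t u v)%:E;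
  (* mutual independence over all rounds and all vertices *)
  choice_independent : forall (s : seq (nat * V)) (B : nat * V -> set V),
    uniq s -> (forall i, i \in s -> (0 < i.1)%N) ->
    Pr (\bigcap_(i in [set` s]) (N i.1 i.2 @^-1` B i)) =
    (\prod_(i <- s) Pr (N i.1 i.2 @^-1` B i))%E
}.

Context {Omega O : Type}.

(* All the opinions on the right-hand side are those at the beginning of the
   round, so the update is simultaneous.                                      *)
Fixpoint opinion (N : nat -> V -> Omega -> V) (xi0 : V -> O) (t : nat)
    (w : Omega) : V -> O :=
  if t is t'.+1 then fun u => opinion N xi0 t' w (N t u w) else xi0.

Definition finally_agrees (N : nat -> V -> Omega -> V) (xi0 : V -> O)
    (sigma : O) : set Omega :=
  [set w | exists t, forall u, opinion N xi0 t w u = sigma].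

End PullVoting.

(* Main.v *)
(* The pi-mass of the holders of sigma is a martingale, because pi is stationary
   for every P_t, and it dominates the indicator of the consensus on sigma.  So
   the process agrees with sigma with probability at most the initial mass of
   sigma.  These bounds sum to 1 over sigma; as a consensus is reached almost
   surely, all of them are equalities.

   In the uniformly irreducible case, all the P_t charge some edge across every
   cut, and all the loops, with at least some fixed beta > 0.  From any
   configuration, the holders of a given opinion thus gain a vertex in one round
   with probability at least beta^n, so that a consensus is reached within n
   rounds with probability at least (beta^n)^n. *)
Require Import Defs.
From HB Require Import structures.
From mathcomp Require Import all_boot all_order all_algebra.
From mathcomp Require Import all_classical all_reals all_analysis.

Set Implicit Arguments.
Unset Strict Implicit.
Unset Printing Implicit Defensive.

Import Order.TTheory GRing.Theory Num.Theory.

Local Open Scope classical_set_scope.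
Local Open Scope ring_scope.

(** * Averages over the picks of one or several rounds *)

Section Averaging.
Context {R : realType} {V O : finType}.
Implicit Types (p : V -> V -> R) (F G : {ffun V -> O} -> R) (x : {ffun V -> O}).

Definition pick_weight p (f : {ffun V -> V}) : R := \prod_u p u (f u).

Definition pull (f : {ffun V -> V}) x : {ffun V -> O} := [ffun u => x (f u)].

(** The Markov operator of one synchronous round: the conditional expectation of [F] after the
    round, given the configuration [x] before it. *)
Definition avg p F x : R := \sum_f pick_weight p f * F (pull f x).

Lemma pick_weight_ge0 p f : transition_matrix p -> 0 <= pick_weight p f.
Proof. by move=> [p01 _]; apply: prodr_ge0 => u _;
  have /andP[] := p01 u (f u). Qed.

Lemma sum_pick_weight p : transition_matrix p -> \sum_f pick_weight p f = 1.
Proof.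
move=> [_ p1]; rewrite -(bigA_distr_bigA p) /=.
by rewrite big1.
Qed.

Lemma sum_pick_weight_at p v (g : V -> R) : transition_matrix p ->
  \sum_f pick_weight p f * g (f v) = \sum_w p v w * g w.
Proof.
move=> [_ p1].
(* Absorbing [g] into the row of [v] makes the sum a product of row sums, in which every other row
   contributes 1. *)
pose q u w := if u == v then p u w * g w else p u w.
transitivity (\sum_(f : {ffun V -> V}) \prod_u q u (f u)).
  apply: eq_bigr => f _; rewrite /pick_weight (bigD1 v)//= [RHS](bigD1 v)//=.
  rewrite {1}/q eqxx mulrAC; congr (_ * _).
  by apply: eq_bigr => u /negPf uv; rewrite /q uv.
rewrite -(bigA_distr_bigA q) (bigD1 v)//= [X in _ * X]big1 ?mulr1.
  by apply: eq_bigr => w _; rewrite /q eqxx.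
by move=> u /negPf uv; rewrite -[RHS](p1 u); apply: eq_bigr => w _;
  rewrite /q uv.
Qed.

Lemma le_avg p F G x : transition_matrix p -> (forall y, F y <= G y) ->
  avg p F x <= avg p G x.
Proof.
by move=> ptr FG; apply: ler_sum => f _; rewrite ler_wpM2l ?pick_weight_ge0.
Qed.

Lemma avg_cst p (c : R) x : transition_matrix p -> avg p (fun=> c) x = c.
Proof. by move=> ptr; rewrite /avg -mulr_suml sum_pick_weight ?mul1r. Qed.

Lemma avg_ge_term p F x f : transition_matrix p -> (forall y, 0 <= F y) ->
  pick_weight p f * F (pull f x) <= avg p F x.
Proof.
move=> ptr F0; rewrite /avg (bigD1 f)//= lerDl.
by apply: sumr_ge0 => g _; rewrite mulr_ge0 ?pick_weight_ge0.
Qed.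

(** The martingale step. By linearity only the law of each single pick matters; exchanging the sums
    gives each holder [w] the coefficient [\sum_v pi v * p v w], which is [pi w]. *)
Lemma avg_stationary_mass p (pi : V -> R) (sigma : O) x :
  transition_matrix p -> stationary p pi ->
  avg p (fun y => \sum_(v | y v == sigma) pi v) x =
  \sum_(v | x v == sigma) pi v.
Proof.
move=> ptr [_ st]; rewrite /avg.
transitivity (\sum_v pi v * \sum_f pick_weight p f * (x (f v) == sigma)%:R).
  under eq_bigr do rewrite big_mkcond mulr_sumr.
  rewrite exchange_big; apply: eq_bigr => v _; rewrite mulr_sumr.
  apply: eq_bigr => f _; rewrite ffunE mulrCA.
  by case: (x (f v) == sigma); rewrite ?mulr1 ?mulr0.
under eq_bigr do rewrite (sum_pick_weight_at _ (fun w => (x w == sigma)%:R))// mulr_sumr.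
rewrite exchange_big [RHS]big_mkcond; apply: eq_bigr => w _ /=.
under eq_bigr do rewrite mulrA.
by rewrite -mulr_suml st; case: eqP; rewrite ?mulr1 ?mulr0.
Qed.

Definition consensus (sigma : O) x : bool := [forall v, x v == sigma].

Lemma pull_consensus sigma f x : consensus sigma x -> consensus sigma (pull f x).
Proof. by move=> /forallP xs; apply/forallP => v; rewrite ffunE. Qed.

(** The points [a] and [b] say that [A] is neither full nor empty. With [A] the holders of an
    opinion, the edge recruits [u] while the loops let all other vertices keep their opinion. *)
Definition expanding (beta : R) p : Prop :=
  (forall v, beta <= p v v) /\
  forall (A : {set V}) a b, a \notin A -> b \in A ->
    exists u v, [/\ u \notin A, v \in A & beta <= p u v].

Lemma holders_grow beta p sigma x j : 0 < beta -> expanding beta p ->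
  (0 < #|[set v | x v == sigma]%SET|)%N ->
  (#|~: [set v | x v == sigma]%SET| <= j.+1)%N ->
  exists f, [/\ beta ^+ #|V| <= pick_weight p f,
    (0 < #|[set v | pull f x v == sigma]%SET|)%N &
    (#|~: [set v | pull f x v == sigma]%SET| <= j)%N].
Proof.
move=> b0 [plazy pcut]; set A := [set v | _]%SET => A0 Aj.
have [AT|[a aA]] : ~: A = finset.set0 \/ exists a, a \in (~: A)%SET.
  by have [|] := set_0Vmem (~: A); [left|case=> a; right; exists a].
  (* Everybody already holds [sigma], and the loops preserve this. *)
  exists [ffun u => u].
  have -> : pull [ffun u => u] x = x by apply/ffunP => u; rewrite !ffunE.
  rewrite -/A A0 AT cards0; split => //.
  rewrite -prodr_const; apply: ler_prod => u _.
  by rewrite ffunE plazy ltW.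
have [b bA] := card_gt0P A0; rewrite inE in aA.
have [u [v [uA vA buv]]] := pcut A a b aA bA.
(* Only [u] picks someone else, namely the holder [v], so the holders become [u |: A]. *)
exists [ffun a => if a == u then v else a].
have -> : [set a | pull [ffun a => if a == u then v else a] x a == sigma]%SET
   = u |: A.
  apply/setP => c; rewrite !inE !ffunE; case: (c == u) => //.
  by move: vA; rewrite inE => ->.
split.
- rewrite -prodr_const; apply: ler_prod => c _; rewrite ffunE ltW//=.
  by case: eqP => [->|].
- by rewrite cardsU1 uA.
- have /eqP := etrans (cardsC (u |: A)) (esym (cardsC A)).
  by rewrite cardsU1 uA add1n addSnnS eqn_add2l => /eqP e; rewrite -ltnS e.
Qed.

Definition has_consensus x : R := [exists sigma, consensus sigma x]%:R.

(** Conditional expectation of [F] at time [t + j], given the configuration [x] at time [t]; the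
    outermost average is over the earliest round. *)
Fixpoint avg_iter (P : nat -> V -> V -> R) t j F x : R :=
  if j is j'.+1 then avg (P t.+1) (avg_iter P t.+1 j' F) x else F x.

(** In each round a single favourable choice of picks is kept, of weight at least [beta ^+ #|V|],
    and it leaves one vertex fewer to convert. *)
Lemma avg_iter_consensus_ge (P : nat -> V -> V -> R) beta sigma j t x :
  (forall t, (0 < t)%N -> transition_matrix (P t)) -> 0 < beta ->
  (forall t, (0 < t)%N -> expanding beta (P t)) ->
  (0 < #|[set v | x v == sigma]%SET|)%N ->
  (#|~: [set v | x v == sigma]%SET| <= j)%N ->
  (beta ^+ #|V|) ^+ j <= avg_iter P t j has_consensus x.
Proof.
move=> Ptr b0 Pexp; elim: j t x => [|j IH] t x A0 Aj.
  rewrite /= /has_consensus expr0; case: existsP => //= -[]; exists sigma.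
  apply/forallP => v; move: Aj; rewrite leqn0 cards_eq0 => /eqP Aj.
  have : v \notin (~: [set v | x v == sigma])%SET by rewrite Aj inE.
  by rewrite !inE negbK.
have [f [wf f0 fj]] := holders_grow b0 (Pexp t.+1 isT) A0 Aj.
apply: le_trans (avg_ge_term _ f (Ptr t.+1 isT) _).
  by rewrite exprS ler_pM// ?exprn_ge0 ?IH// ltW.
(* Discarding the other picks requires the iterated average to be nonnegative, which is a separate
   induction. *)
elim: {IH Aj fj} j t.+1 => [|j IH] s y /=; first by rewrite ler0n.
rewrite -(avg_cst 0 y (Ptr s.+1 isT)); apply: le_avg; first exact: Ptr.
exact: IH.
Qed.

Lemma avg_iter_ge (P : nat -> V -> V -> R) F j t x :
  (forall t, (0 < t)%N -> transition_matrix (P t)) ->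
  (forall f y, F y <= F (pull f y)) -> F x <= avg_iter P t j F x.
Proof.
move=> Ptr Fup; elim: j t x => [|j IH] t x //=.
rewrite -{1}(avg_cst (F x) x (Ptr t.+1 isT)); apply: ler_sum => f _.
by rewrite ler_wpM2l ?pick_weight_ge0 ?(le_trans (Fup f x))//; exact: Ptr.
Qed.

Lemma le_has_consensus_pull f x : has_consensus x <= has_consensus (pull f x).
Proof.
rewrite ler_nat; case: existsP => // -[s xs]; rewrite lt0b; apply/existsP;
  exists s.
exact: pull_consensus.
Qed.

(** A consensus is absorbing, which settles the case where there is one. Otherwise the opinion of
    any vertex has a holder and lacks at most [#|V|] vertices. *)
Lemma avg_iter_has_consensus (P : nat -> V -> V -> R) beta t x :
  (forall t, (0 < t)%N -> transition_matrix (P t)) -> 0 < beta ->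
  (forall t, (0 < t)%N -> expanding beta (P t)) -> (0 < #|V|)%N ->
  1 - avg_iter P t #|V| has_consensus x <=
  (1 - (beta ^+ #|V|) ^+ #|V|) * (1 - has_consensus x).
Proof.
move=> Ptr b0 Pexp /card_gt0P[v _].
have [c1|/eqP] := eqVneq (has_consensus x) 1.
  by rewrite c1 subrr mulr0 subr_le0 -{1}c1; apply: avg_iter_ge => // *;
    exact: le_has_consensus_pull.
rewrite {2}/has_consensus; rewrite /has_consensus; case: [exists _, _] => //= _.
rewrite subr0 mulr1 lerB// (avg_iter_consensus_ge _ (sigma := x v))//.
  by apply/card_gt0P; exists v; rewrite inE.
exact: max_card.
Qed.

End Averaging.

(** * From uniform irreducibility to edges across every cut *)

Section Expansion.
Context {R : realType} {V : finType}.
Implicit Types p : V -> V -> R.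

Lemma mpow_le1 p k u v : transition_matrix p -> mpow p k u v <= 1.
Proof.
move=> [p01 p1]; elim: k u => [|k IH] u /=; first by rewrite lern1 leq_b1.
rewrite -(p1 u); apply: ler_sum => w _; rewrite ler_piMr//.
by have /andP[] := p01 u w.
Qed.

(** A union bound over the step at which the chain first enters [A]: each step has at most [#|V|]
    targets, each of probability at most [beta]. *)
Lemma mpow_cut_le p (beta : R) (A : {set V}) k u v : transition_matrix p ->
  0 <= beta -> (forall u v, u \notin A -> v \in A -> p u v <= beta) ->
  u \notin A -> v \in A -> mpow p k u v <= (k * #|V|)%:R * beta.
Proof.
move=> ptr b0 pA + vA; have [p01 p1] := ptr.
elim: k u => [|k IH] u uA /=.
  by case: eqP uA => [->|_ _]; [rewrite vA|rewrite mul0r].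
(* The first summand covers a first step into [A], the second one the induction hypothesis outside
   [A]; adding both for every [w] avoids splitting the sum. *)
apply: (@le_trans _ _ (\sum_w (beta + p u w * ((k * #|V|)%:R * beta)))).
  apply: ler_sum => w _; have /andP[p0 _] := p01 u w.
  have kb0 : 0 <= (k * #|V|)%:R * beta by rewrite mulr_ge0.
  have [wA|wA] := boolP (w \in A).
    apply: ler_wpDr; first exact: mulr_ge0.
    by rewrite (le_trans _ (pA u w uA wA))// ler_piMr// mpow_le1.
  by apply: ler_wpDl => //; rewrite ler_wpM2l// IH.
rewrite big_split/= -mulr_suml p1 mul1r sumr_const mulSn natrD mulrDl.
by rewrite [in leRHS]mulr_natl.
Qed.

Lemma uniformly_irreducible_expanding (P : nat -> V -> V -> R) :
  (forall t, (0 < t)%N -> transition_matrix (P t)) ->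
  (forall t, (0 < t)%N -> lazy (P t)) -> uniformly_irreducible P ->
  exists2 beta : R, 0 < beta & forall t, (0 < t)%N -> expanding beta (P t).
Proof.
move=> Ptr Plazy [K [eps [eps0 Pirr]]].
set M : R := (K * #|V|)%:R.
have M1 : 0 < M + 1 by rewrite ltr_wpDl.
have e0 : 0 < eps / (M + 1) by rewrite divr_gt0.
(* Laziness gives [2^-1] on the loops. If all edges across a cut had weight at most [eps / (M + 1)],
   crossing it within [K] steps would have probability at most [M * (eps / (M + 1))], which is below
   [eps]. *)
exists (Num.min 2^-1 (eps / (M + 1)));
  first by rewrite lt_min invr_gt0 ltr0n e0.
move=> t t0; split=> [v|A a b aA bA].
  by rewrite ge_min Plazy.
apply: contrapT => nocut.
have [k /andP[_ kK]] := Pirr t a b t0; apply/negP; rewrite -ltNge.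
have pA u v : u \notin A -> v \in A -> P t u v <= eps / (M + 1).
  move=> uA vA; rewrite leNgt; apply/negP => lt_p; apply: nocut.
  by exists u, v; split => //; rewrite ge_min (ltW lt_p) orbT.
apply: le_lt_trans (mpow_cut_le k (Ptr t t0) (ltW e0) pA aA bA) _.
apply: (@le_lt_trans _ _ (M * (eps / (M + 1)))).
  by rewrite ler_wpM2r ?(ltW e0)// ler_nat leq_mul2r kK orbT.
by rewrite mulrA ltr_pdivrMr// mulrC ltr_pM2l// ltrDl.
Qed.

End Expansion.

Lemma setT_index_enum (T : finType) : [set: T] = [set` index_enum T].
Proof. by apply/seteqP; split=> // x _ /=; rewrite mem_index_enum. Qed.

(** * Finite-valued random variables and total probability *)

Section FiniteFibers.
Context {d} {Omega : measurableType d} {R : realType} {T : finType}.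
Variables (mu : probability Omega R) (X : Omega -> T).
Hypothesis mX : forall x, measurable (X @^-1` [set x]).

Lemma measurable_finite_preimage (B : set T) : measurable (X @^-1` B).
Proof.
have -> : X @^-1` B = \bigcup_(x in B) X @^-1` [set x].
  by apply/seteqP; split=> [w Bw|w [x Bx wx]]; [exists (X w)|rewrite /= wx].
by apply: fin_bigcup_measurable => //; exact: finite_finset.
Qed.

Lemma measure_sum_fibers A : measurable A ->
  (mu A = \sum_x mu (A `&` X @^-1` [set x]))%E.
Proof.
move=> mA; transitivity (mu (\bigcup_(x in [set: T]) (A `&` X @^-1` [set x]))).
  congr (mu _); apply/seteqP; split=> [w Aw|w [x _ []]//].
  by exists (X w).
rewrite measure_fin_bigcup.
- by rewrite setT_index_enum -fsbig_seq ?index_enum_uniq.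
- exact: finite_finset.
- exact: trivIset_preimage1_in.
- by move=> x _; apply: measurableI.
Qed.

End FiniteFibers.

(** * The law of the configuration, as a recursion without probability space *)

Section Law.
Context {R : realType} {V O : finType}.
Variables (P : nat -> V -> V -> R) (xi0 : V -> O).
Hypothesis P_trans : forall t, (0 < t)%N -> transition_matrix (P t).

(** Averaging the indicator of [y] from [x] gives the transition probability from [x] to [y]. That
    this is the law of the actual process is proved in [config_law]. *)
Fixpoint law t (y : {ffun V -> O}) : R :=
  if t is t'.+1 then
    \sum_x law t' x * avg (P t) (fun z => (z == y)%:R) x
  else (y == finfun xi0)%:R.

Definition expect t (F : {ffun V -> O} -> R) : R := \sum_x law t x * F x.

Lemma expect0 F : expect 0 F = F (finfun xi0).
Proof.
rewrite /expect (bigD1 (finfun xi0))//= eqxx mul1r big1 ?addr0// => x /negPf ->.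
by rewrite mul0r.
Qed.

Lemma expectS t F : expect t.+1 F = expect t (avg (P t.+1) F).
Proof.
rewrite /expect /=; under eq_bigr do rewrite mulr_suml.
rewrite exchange_big; apply: eq_bigr => x _ /=.
under eq_bigr do rewrite -mulrA mulr_suml.
rewrite -mulr_sumr exchange_big; congr (_ * _); apply: eq_bigr => f _ /=.
under eq_bigr do rewrite -mulrA.
rewrite -mulr_sumr; congr (_ * _).
rewrite (bigD1 (pull f x))//= eqxx mul1r big1 ?addr0// => y.
by rewrite eq_sym => /negPf ->; rewrite mul0r.
Qed.

Lemma law_ge0 t y : 0 <= law t y.
Proof.
elim: t y => [|t IH] y /=; first by rewrite ler0n.
apply: sumr_ge0 => x _; rewrite mulr_ge0//; apply: sumr_ge0 => f _.
by rewrite mulr_ge0 ?ler0n// pick_weight_ge0//; exact: P_trans.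
Qed.

Lemma le_expect t F G : (forall x, F x <= G x) -> expect t F <= expect t G.
Proof. by move=> FG; apply: ler_sum => x _; rewrite ler_wpM2l// law_ge0. Qed.

Lemma expect_cst t (c : R) : expect t (fun=> c) = c.
Proof.
elim: t => [|t IH]; first by rewrite expect0.
by rewrite expectS -[RHS]IH; apply: eq_bigr => x _; rewrite avg_cst//;
  exact: P_trans.
Qed.

Lemma expect_affine t (a b : R) F :
  expect t (fun x => a * (b - F x)) = a * (b - expect t F).
Proof.
rewrite -{2}(expect_cst t b) /expect -sumrB mulr_sumr.
by apply: eq_bigr => x _; rewrite mulrCA -mulrBr.
Qed.

Lemma expect_avg_iter t j F : expect (t + j) F = expect t (avg_iter P t j F).
Proof.
by elim: j t => [|j IH] t /=; [rewrite addn0|rewrite -addSnnS IH expectS].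
Qed.

Lemma expect_stationary_mass t pi sigma :
  (forall t, (0 < t)%N -> stationary (P t) pi) ->
  expect t (fun y => \sum_(v | y v == sigma) pi v) =
  \sum_(v | xi0 v == sigma) pi v.
Proof.
move=> Pst; elim: t => [|t IH].
  by rewrite expect0; apply: eq_bigl => v; rewrite ffunE.
rewrite expectS -[RHS]IH; apply: eq_bigr => x _; congr (_ * _).
by apply: avg_stationary_mass; [exact: P_trans|exact: Pst].
Qed.

(** Under consensus on [sigma] its mass is 1, and otherwise it is nonnegative; the expected mass
    stays constant. *)
Lemma expect_consensus_le t pi sigma :
  (forall t, (0 < t)%N -> stationary (P t) pi) ->
  expect t (fun x => (consensus sigma x)%:R) <= \sum_(v | xi0 v == sigma) pi v.
Proof.
move=> Pst; rewrite -(expect_stationary_mass t sigma Pst).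
have [[pi0 pi1] _] := Pst 1%N isT.
apply: le_expect => x; case: (boolP (consensus sigma x)) => [/forallP xs|_].
  by rewrite -pi1; under [leRHS]eq_bigl do rewrite xs.
by apply: sumr_ge0.
Qed.

(** Time is cut into blocks of [#|V|] rounds; each block multiplies the probability of no consensus
    by at most [c], whatever the configuration at its start. *)
Lemma expect_no_consensus_le beta k : (0 < #|V|)%N -> 0 < beta ->
  (forall t, (0 < t)%N -> expanding beta (P t)) ->
  1 - expect (k * #|V|) has_consensus <= (1 - (beta ^+ #|V|) ^+ #|V|) ^+ k.
Proof.
move=> V0 b0 Pexp; set c := 1 - (beta ^+ _) ^+ _.
(* This needs [beta <= 1], which holds because [beta] is below a diagonal entry of [P 1]. *)
have c0 : 0 <= c.
  rewrite subr_ge0 -exprM exprn_ile1 ?(ltW b0)//.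
  have [v _] := card_gt0P V0; have [+ _] := Pexp 1%N isT => /(_ v) bv.
  by apply: le_trans bv _; have [/(_ v v)/andP[]] := P_trans (isT : 0 < 1)%N.
elim: k => [|k IH].
  rewrite expr0 gerBl; rewrite -(expect_cst 0 0); apply: le_expect => x.
  exact: ler0n.
rewrite exprS; apply: le_trans (ler_wpM2l c0 IH).
rewrite mulSnr expect_avg_iter -[leLHS]mul1r -!expect_affine.
apply: le_expect => x; rewrite mul1r.
exact: avg_iter_has_consensus.
Qed.

(** * The random process and its law *)

Context {d} {Omega : measurableType d} (Pr : probability Omega R).
Variable N : nat -> V -> Omega -> V.
Hypothesis N_choices : pull_choices Pr P N.

Definition config t w : {ffun V -> O} := finfun (opinion N xi0 t w).

Definition picks t w : {ffun V -> V} := [ffun u => N t u w].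

Lemma config0 : config 0 = cst (finfun xi0).
Proof. by []. Qed.

Lemma configS t w : config t.+1 w = pull (picks t.+1 w) (config t w).
Proof. by apply/ffunP => u; rewrite !ffunE. Qed.

Definition picked (s : seq (nat * V)) (b : nat * V -> V) : set Omega :=
  \bigcap_(i in [set` s]) (N i.1 i.2 @^-1` [set b i]).

Definition round t : seq (nat * V) := [seq (t, u) | u <- enum V].

Lemma measurable_picked s b : (forall i, i \in s -> (0 < i.1)%N) ->
  measurable (picked s b).
Proof.
move=> s0; apply: fin_bigcap_measurable; first exact: finite_seq.
by move=> i /= /s0; exact: (choice_measurable N_choices).
Qed.

Lemma mem_round t i : (i \in round t) = (i.1 == t).
Proof.
apply/mapP/eqP => [[u _ ->]//|it]; exists i.2; first by rewrite mem_enum.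
by case: i it => ? ? /= ->.
Qed.

Lemma picksE t f : picks t @^-1` [set f] = picked (round t) (f \o snd).
Proof.
apply/seteqP; split=> [w /= <- i /=|w H /=].
  by rewrite mem_round => /eqP ->; rewrite ffunE.
by apply/ffunP => u; rewrite ffunE; apply: (H (t, u)); rewrite /= mem_round.
Qed.

Lemma measurable_picks t f : (0 < t)%N -> measurable (picks t @^-1` [set f]).
Proof.
move=> t0; rewrite picksE; apply: measurable_picked => i.
by rewrite mem_round => /eqP ->.
Qed.

Lemma measurable_config_picks t y f :
  (forall x, measurable (config t @^-1` [set x])) ->
  measurable ((fun w => (config t w, picks t.+1 w)) @^-1` [set (y, f)]).
Proof.
move=> mc; rewrite (_ : _ @^-1` _ =
    config t @^-1` [set y] `&` picks t.+1 @^-1` [set f]).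
  by apply: measurableI => //; exact: measurable_picks.
by apply/seteqP; split=> [w [<- <-]//|w /= [-> ->]].
Qed.

Lemma measurable_config t x : measurable (config t @^-1` [set x]).
Proof.
elim: t x => [|t IH] x.
  rewrite config0 preimage_cst; case: ifP => _;
    [exact: measurableT|exact: measurable0].
rewrite (_ : _ @^-1` _ = (fun w => (config t w, picks t.+1 w)) @^-1`
    [set z | pull z.2 z.1 = x]).
  apply: measurable_finite_preimage => -[y f].
  exact: measurable_config_picks.
by apply/seteqP; split=> w /=; rewrite configS.
Qed.

(* The future choices are kept in the statement so that the induction on [t]
   can absorb the choices of one more round. *)
Lemma config_picked_law t x s b : uniq s -> (forall i, i \in s -> (t < i.1)%N) ->
  Pr (config t @^-1` [set x] `&` picked s b) =
  (law t x * \prod_(i <- s) P i.1 i.2 (b i))%:E.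
Proof.
elim: t x s b => [|t IH] y s b us st.
  rewrite config0 preimage_cst /=; case: ifPn => [/set_mem/= <-|xy].
    rewrite eqxx mul1r setTI (choice_independent N_choices)// -prodEFin.
    rewrite big_seq [RHS]big_seq; apply: eq_bigr => i /st.
    exact: (choice_law N_choices).
  rewrite set0I measure0; case: eqP xy => [->|_ _]; last by rewrite mul0r.
  by rewrite mem_set.
have ms : measurable (picked s b).
  by apply: measurable_picked => i /st; exact: leq_trans.
(* Condition on the configuration at time [t] and on the picks of the next round, which together
   determine the configuration at time [t.+1]. *)
rewrite (measure_sum_fibers Pr (X := fun w => (config t w, picks t.+1 w)));
  last 2 first.
- by move=> [x f]; apply: measurable_config_picks; exact: measurable_config.
- by apply: measurableI => //; exact: measurable_config.
have -> : law t.+1 y * \prod_(i <- s) P i.1 i.2 (b i) = \sum_x \sum_f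
    law t x * (pick_weight (P t.+1) f * (pull f x == y)%:R) *
    \prod_(i <- s) P i.1 i.2 (b i).
  by rewrite /= mulr_suml; apply: eq_bigr => x _;
    rewrite /avg mulr_sumr mulr_suml.
rewrite pair_bigA /= -sumEFin; apply: eq_bigr => -[x f] _ /=.
have [fxy|fxy] := eqVneq (pull f x) y; last first.
  rewrite !mulr0 mul0r (_ : _ `&` _ = set0) ?measure0//.
  apply/seteqP; split=> // w /= [[+ _] [cx pf]].
  by rewrite configS cx pf => /eqP; rewrite (negPf fxy).
(* The picks [f] of round [t.+1] join the later ones prescribed by [b]. All rounds in [s] come after
   [t.+1], so the two prescriptions never clash. *)
pose b' i := if i.1 == t.+1 then f i.2 else b i.
have sr i : i \in s -> (i.1 == t.+1) = false.
  by move=> /st; rewrite eq_sym ltn_neqAle => /andP[/negPf].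
rewrite (_ : _ `&` _ = config t @^-1` [set x] `&` picked (round t.+1 ++ s) b').
  rewrite IH; last 2 first.
  - rewrite cat_uniq us andbT map_inj_uniq ?enum_uniq; last by move=> ? ? [].
    by apply/hasPn => i /sr; rewrite mem_round => ->.
  - move=> i; rewrite mem_cat mem_round => /orP[/eqP ->//|/st].
    exact: ltnW.
  rewrite big_cat mulr1 -mulrA; congr (_ * (_ * _))%:E.
    rewrite /round big_map big_enum; apply: eq_bigr => u _.
    by rewrite /b' eqxx.
  by rewrite big_seq [RHS]big_seq; apply: eq_bigr => i /sr; rewrite /b' => ->.
apply/seteqP; split=> w /=.
- move=> [[_ ws] [cx pf]]; split=> // i /=.
  rewrite mem_cat mem_round /b'; case: eqP => /= [-> _|_ /ws//].
  by rewrite -pf ffunE.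
- move=> [cx ws].
  have pf : picks t.+1 w = f.
    apply/ffunP => u; rewrite ffunE; have := ws (t.+1, u).
    by rewrite /= mem_cat mem_round /b' eqxx; exact.
  split; last by rewrite cx pf.
  split; first by rewrite configS cx pf.
  move=> i /= si; have := ws i; rewrite /= mem_cat si orbT /b' (sr i si).
  exact.
Qed.

Lemma config_law t x : Pr (config t @^-1` [set x]) = (law t x)%:E.
Proof.
have := @config_picked_law t x [::] snd isT; rewrite big_nil mulr1 => <-//.
congr (Pr _); rewrite /picked; apply/seteqP; split=> [w wx|w []//].
by split.
Qed.

Lemma config_expect t (B : pred {ffun V -> O}) :
  Pr [set w | B (config t w)] = (expect t (fun x => (B x)%:R))%:E.
Proof.
have mc := measurable_config t.
rewrite (measure_sum_fibers Pr mc); last first.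
  exact: (measurable_finite_preimage mc [set x | B x]).
rewrite -sumEFin; apply: eq_bigr => x _.
have [Bx|nBx] := boolP (B x).
  rewrite mulr1 -config_law; congr (Pr _).
  by apply/seteqP; split=> [w []//|w /= wx]; rewrite wx.
rewrite mulr0 (_ : _ `&` _ = set0) ?measure0//.
by apply/seteqP; split=> // w /= [+ wx]; rewrite wx (negPf nBx).
Qed.

(** * Probabilities of final agreement *)

Lemma finally_agreesE sigma :
  finally_agrees N xi0 sigma = \bigcup_t [set w | consensus sigma (config t w)].
Proof.
apply/seteqP; split=> [w [t wt]|w [t _ /forallP wt]].
  by exists t => //=; apply/forallP => u; rewrite ffunE wt.
by exists t => u; have /eqP := wt u; rewrite ffunE.
Qed.

Lemma measurable_consensus sigma t :
  measurable [set w | consensus sigma (config t w)].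
Proof.
exact: (measurable_finite_preimage (measurable_config t) [set x | consensus sigma x]).
Qed.

Lemma measurable_finally_agrees sigma : measurable (finally_agrees N xi0 sigma).
Proof.
by rewrite finally_agreesE; apply: bigcup_measurable => t _;
  exact: measurable_consensus.
Qed.

(** Consensus persists, so the events increase with time and continuity from below carries the bound
    at each fixed time to their union. *)
Lemma finally_agrees_le pi sigma :
  (forall t, (0 < t)%N -> stationary (P t) pi) ->
  (Pr (finally_agrees N xi0 sigma) <= (\sum_(v | xi0 v == sigma) pi v)%:E)%E.
Proof.
move=> Pst; rewrite finally_agreesE.
apply: (@cvge_le _ _ _ _ _ _ _ _ (nondecreasing_cvg_mu (mu := Pr)
  (F := fun t => [set w | consensus sigma (config t w)]) _ _ _)).
- by near=> t; rewrite /= config_expect lee_fin expect_consensus_le.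
- exact: measurable_consensus.
- by apply: bigcup_measurable => t _; exact: measurable_consensus.
- apply/nondecreasing_seqP => t; apply/subsetPset => w /=.
  by rewrite configS; exact: pull_consensus.
Unshelve. all: by end_near.
Qed.

Lemma measurable_some_agreement :
  measurable (\bigcup_(s in [set: O]) finally_agrees N xi0 s).
Proof.
apply: fin_bigcup_measurable; first exact: finite_finset.
by move=> s _; exact: measurable_finally_agrees.
Qed.

Lemma some_agreement_expanding beta : (0 < #|V|)%N -> 0 < beta ->
  (forall t, (0 < t)%N -> expanding beta (P t)) ->
  Pr (\bigcup_(s in [set: O]) finally_agrees N xi0 s) = 1%E.
Proof.
move=> V0 b0 Pexp; apply/eqP; rewrite eq_le probability_le1/=; last first.
  exact: measurable_some_agreement.
set c := (beta ^+ #|V|) ^+ #|V|.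
have c0 : 0 < c by rewrite !exprn_gt0.
(* After one block, [1 - c] dominates a probability of no consensus, which is nonnegative. *)
have c1 : c <= 1.
  rewrite -subr_ge0 -[1 - c]expr1;
    apply: le_trans (expect_no_consensus_le 1 V0 b0 Pexp).
  rewrite subr_ge0 -[leRHS](expect_cst (1 * #|V|) 1); apply: le_expect => x.
  by rewrite lern1 leq_b1.
have cvg1 : (1 - (1 - c) ^+ k)%:E @[k --> \oo] --> 1%:E.
  apply: cvg_EFin; first by near=> k.
  rewrite -[X in _ --> X]subr0; apply: cvgB; first exact: cvg_cst.
  by apply: cvg_expr; rewrite ger0_norm ?subr_ge0// gtrBl.
apply: (cvge_le _ cvg1); near=> k.
apply: (@le_trans _ _ (Pr [set w | [exists s, consensus s (config (k * #|V|) w)]])).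
  rewrite (config_expect _ (fun x => [exists s, consensus s x])).
  by rewrite lee_fin lerBlDr -lerBlDl expect_no_consensus_le.
apply: le_measure; rewrite ?inE.
- exact: (measurable_finite_preimage (measurable_config _)
    [set x | [exists s, consensus s x]]).
- exact: measurable_some_agreement.
- move=> w /= /existsP[s ws]; exists s => //; rewrite finally_agreesE.
  by exists (k * #|V|)%N.
Unshelve. all: by end_near.
Qed.

Lemma some_agreement_ae :
  {ae Pr, forall w, exists s, finally_agrees N xi0 s w} ->
  Pr (\bigcup_(s in [set: O]) finally_agrees N xi0 s) = 1%E.
Proof.
move=> [Z [mZ Z0 subZ]]; apply/eqP; rewrite eq_le probability_le1/=; last first.
  exact: measurable_some_agreement.
rewrite -[leLHS]sube0 -Z0 -probability_setC//.
apply: le_measure; rewrite ?inE;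
  [exact: measurableC|exact: measurable_some_agreement|].
move=> w nZw; apply: contrapT => nw; apply/nZw/subZ => -[s ws].
by apply: nw; exists s.
Qed.

(** The upper bounds sum to 1, since the initial opinions partition [V], while by the union bound
    the probabilities sum to at least 1. A strict inequality at [sigma] would contradict this. *)
Lemma finally_agrees_prob pi sigma :
  (forall t, (0 < t)%N -> stationary (P t) pi) ->
  Pr (\bigcup_(s in [set: O]) finally_agrees N xi0 s) = 1%E ->
  Pr (finally_agrees N xi0 sigma) = (\sum_(v | xi0 v == sigma) pi v)%:E.
Proof.
move=> Pst agree1; have [[_ pi1] _] := Pst 1%N isT.
pose q s := fine (Pr (finally_agrees N xi0 s)).
have qE s : Pr (finally_agrees N xi0 s) = (q s)%:E.
  by rewrite fineK// fin_num_measure//; exact: measurable_finally_agrees.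
have q_le s : q s <= \sum_(v | xi0 v == s) pi v.
  by rewrite -lee_fin -qE finally_agrees_le.
have q_ge1 : 1 <= \sum_s q s.
  rewrite -lee_fin -sumEFin -agree1.
  apply: le_trans (content_sub_fsum Pr (@finite_finset O setT) _
    measurable_some_agreement (@subset_refl _ _)) _.
    by move=> s _; exact: measurable_finally_agrees.
  rewrite setT_index_enum -fsbig_seq ?index_enum_uniq//.
  by apply: lee_sum => s _; rewrite -qE.
rewrite qE; congr (_%:E); apply/eqP; rewrite eq_le q_le/= leNgt;
  apply/negP => lt_q.
move: q_ge1; apply/negP; rewrite -ltNge -pi1.
rewrite [ltRHS](partition_big xi0 xpredT)//=.
by rewrite (bigD1 sigma)//= [ltRHS](bigD1 sigma)//= ltr_leD// ler_sum.
Qed.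

End Law.

Theorem proposition1p10 (R : realType) (V : finType)
    (P : nat -> V -> V -> R) (pi : V -> R)
    (P_trans : forall t, (1 <= t)%N -> transition_matrix (P t))
    (P_irr : forall t, (1 <= t)%N -> irreducible (P t))
    (P_lazy : forall t, (1 <= t)%N -> lazy (P t))
    (P_stat : forall t, (1 <= t)%N -> stationary (P t) pi)
    (P_rev : forall t, (1 <= t)%N -> reversible (P t) pi)
    (d : measure_display) (Omega : measurableType d) (Pr : probability Omega R)
    (N : nat -> V -> Omega -> V)
    (N_choices : pull_choices Pr P N)
    (Sigma : {set 'I_#|V|}) (xi0 : V -> 'I_#|V|)
    (xi0_Sigma : forall v, xi0 v \in Sigma)
    (no_freeze : uniformly_irreducible P \/
       {ae Pr, forall w, exists s, finally_agrees N xi0 s w})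
    (sigma : 'I_#|V|) (sigma_Sigma : sigma \in Sigma) :
  Pr (finally_agrees N xi0 sigma) =
  (\sum_(v in [set v : V | xi0 v == sigma]%SET) pi v)%:E.
Proof.
(* An empty [V] would make the total mass of [pi] equal to 0 instead of 1. *)
have V0 : (0 < #|V|)%N.
  have [[_ pi1] _] := P_stat 1%N (leqnn 1); rewrite lt0n; apply/negP => /eqP V0.
  move: pi1; rewrite big_pred0 => [/esym/eqP|v]; first by rewrite oner_eq0.
  by have := max_card (pred1 v); rewrite card1 V0.
under eq_bigl do rewrite inE.
apply: (finally_agrees_prob P_trans N_choices) => //.
case: no_freeze => [Pirr|]; last exact: some_agreement_ae N_choices.
have [beta b0 Pexp] := uniformly_irreducible_expanding P_trans P_lazy Pirr.
exact: (some_agreement_expanding xi0 P_trans N_choices V0 b0 Pexp).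
Qed.
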